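(* Let $(B,\mathcal{A})$ be a subcomplete Boolean admissibility system, and let $C_{\mathcal{A}}$ be the frame of all ideals $I\subseteq B$ such that $\bigvee R\in I$ whenever $R\in\mathcal{A}$ and $R\subseteq I$. Then the frame $C_{\mathcal{A}}$ is ultraparacompact if and only if for every $R\in\mathcal{A}$ there is some $S\in\mathcal{A}$ with $S\preceq R$, $\bigvee S=\bigvee R$, and $a\wedge b=0$ whenever $a,b\in S$ and $a\neq b$.
   Context: In a poset $X$, $\downarrow x=\{y\in X\mid y\leq x\}$, and for $R,S\subseteq X$, $R\preceq S$ ($R$ refines $S$) means that for each $r\in R$ there is $s\in S$ with $r\leq s$. A Boolean admissibility system is a pair $(B,\mathcal{A})$ where $B$ is a Boolean algebra and $\mathcal{A}$ is a collection of subsets of $B$, each having a least upper bound in $B$, such that: (i) $\mathcal{A}$ contains all finite subsets of $B$; (ii) if $R\in\mathcal{A}$, $S\subseteq\downarrow\bigvee R$ and $R\preceq S$, then $S\in\mathcal{A}$; (iii) if $R\in\mathcal{A}$ and for each $r\in R$ we have $R_r\in\mathcal{A}$ with $\bigvee R_r=r$, then $\bigcup_{r\in R}R_r\in\mathcal{A}$; (iv) if $R\in\mathcal{A}$ and $a\in B$, then $\{a\wedge r\mid r\in R\}\in\mathcal{A}$. It is subcomplete if whenever $R,S\subseteq B$, $R\cup S\in\mathcal{A}$ and $r\wedge s=0$ for all $r\in R$, $s\in S$, then $R\in\mathcal{A}$ and $S\in\mathcal{A}$. Ideals of $B$ are not required to be proper; $C_{\mathcal{A}}$ is ordered by inclusion.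 A frame is a complete lattice satisfying $x\wedge\bigvee_{i\in I}y_i=\bigvee_{i\in I}(x\wedge y_i)$. An element $x$ of a frame $L$ is complemented if there is $y\in L$ with $x\wedge y=0$ and $x\vee y=1$; $\mathfrak{B}(L)$ is the set of complemented elements. A frame $L$ is zero-dimensional if $x=\bigvee\{y\in\mathfrak{B}(L)\mid y\leq x\}$ for each $x\in L$. A cover of a frame $L$ is a subset $C\subseteq L$ with $\bigvee C=1$. A partition of $L$ is a subset $p\subseteq L\setminus\{0\}$ with $\bigvee p=1$ and $a\wedge b=0$ whenever $a,b\in p$, $a\neq b$. A zero-dimensional frame $L$ is ultraparacompact if every cover $C$ of $L$ is refined by some partition $p$ of $L$, i.e. $p\preceq C$. (The frame $C_{\mathcal{A}}$ is zero-dimensional.) *)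

(* Defs.v *)
From HB Require Import structures.
From mathcomp Require Import all_boot all_order.
From mathcomp Require Import boolp classical_sets cardinality.

Set Implicit Arguments.
Unset Strict Implicit.
Unset Printing Implicit Defensive.

Import Order.LTheory Order.CTheory.
Local Open Scope classical_set_scope.
Local Open Scope order_scope.

(* Least upper bounds are expressed relationally: [supremums S x] means that
   x is the least upper bound of S. *)

Definition refines d (X : porderType d) (R S : set X) : Prop :=
  forall r, R r -> exists2 s, S s & r <= s.

Definition pairwise_disjoint d (X : bMeetSemilatticeType d) (S : set X) :
    Prop :=
  forall a b, S a -> S b -> a <> b -> a `&` b = \bot.

(* The distributive law is stated for subsets S of L rather than for indexed
   families; a family has the same joins as its range. *)
HB.mixin Record TBLattice_isFrame d L of Order.TBLattice d L := {
  supremums_ex : forall S : set L, exists x, supremums S x;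
  meet_supremums : forall (x : L) (S : set L) (y : L), supremums S y ->
    supremums [set x `&` s | s in S] (x `&` y)
}.

#[short(type="frameType")]
HB.structure Definition Frame d :=
  { L of TBLattice_isFrame d L & Order.TBLattice d L }.

Section FrameNotions.
Context d (L : frameType d).

Definition complemented : set L :=
  [set x | exists y, x `&` y = \bot /\ x `|` y = \top].

Definition zero_dimensional : Prop :=
  forall x : L, supremums [set y | complemented y /\ y <= x] x.

Definition frame_cover (C : set L) : Prop := supremums C \top.

Definition frame_partition (p : set L) : Prop :=
  [/\ ~ p \bot, supremums p \top & pairwise_disjoint p].

Definition ultraparacompact : Prop :=
  zero_dimensional /\
  forall C, frame_cover C -> exists2 p, frame_partition p & refines p C.

End FrameNotions.
Arguments zero_dimensional {d} L.
Arguments ultraparacompact {d} L.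

(* [ctbDistrLatticeType d] is the type of Boolean algebras; the one-element
   algebra is allowed. *)
Record admSystem d (B : ctbDistrLatticeType d) := AdmSystem {
  adm : set (set B);
  adm_lub : forall R, adm R -> exists x, supremums R x;
  adm_finite : forall R, finite_set R -> adm R;
  adm_refine : forall R S x, adm R -> supremums R x ->
    (forall s, S s -> s <= x) -> refines R S -> adm S;
  adm_bigcup : forall (R : set B) (F : B -> set B), adm R ->
    (forall r, R r -> adm (F r) /\ supremums (F r) r) ->
    adm (\bigcup_(r in R) F r);
  adm_meet : forall R a, adm R -> adm [set a `&` r | r in R]
}.

Section AdmissibleIdeals.
Context d (B : ctbDistrLatticeType d) (A : admSystem B).

Definition subcomplete : Prop :=
  forall R S : set B, adm A (R `|` S)%classic ->
  (forall r s, R r -> S s -> r `&` s = \bot) -> adm A R /\ adm A S.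

Definition ideal (I : set B) : Prop :=
  [/\ I \bot,
      forall a b, I b -> a <= b -> I a &
      forall a b, I a -> I b -> I (a `|` b)].

Definition adm_closed (I : set B) : Prop :=
  forall R x, adm A R -> (R `<=` I)%classic -> supremums R x -> I x.

Record admIdeal := AdmIdeal {
  admIdeal_set :> set B;
  admIdealP_subproof : `[< ideal admIdeal_set /\ adm_closed admIdeal_set >]
}.

HB.instance Definition _ := [isSub for admIdeal_set].
HB.instance Definition _ := [Choice of admIdeal by <:].
HB.instance Definition _ :=
  [SubChoice_isSubPOrder of admIdeal by <: with set_display].

Implicit Types (I J : admIdeal) (SS : set admIdeal).

Lemma admIdealP I : ideal I /\ adm_closed I.
Proof. by case: I => I /= /asboolP. Qed.

Lemma le_admIdeal I J : (I <= J) = (I `<=` J)%classic :> Prop.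
Proof. by rewrite -subsetEset. Qed.

Fact admIdeal_bigcap_subproof SS : `[< ideal (\bigcap_(J in SS) (J : set B)) /\
  adm_closed (\bigcap_(J in SS) (J : set B)) >].
Proof.
apply/asboolP; split; first split.
- by move=> J _; case: (admIdealP J) => -[].
- move=> a b Ib ab J SJ; case: (admIdealP J) => -[_ h _] _.
  exact: h (Ib _ SJ) ab.
- move=> a b Ia Ib J SJ; case: (admIdealP J) => -[_ _ h] _.
  exact: h (Ia _ SJ) (Ib _ SJ).
- move=> R x AR RI Rx J SJ; case: (admIdealP J) => _ h.
  by apply: (h R x AR _ Rx) => r Rr; exact: RI.
Qed.
Definition admIdeal_bigcap SS := AdmIdeal (admIdeal_bigcap_subproof SS).

Definition admIdeal_sup SS := admIdeal_bigcap (ubound SS).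

Lemma admIdeal_supP SS : supremums SS (admIdeal_sup SS).
Proof.
split.
- by move=> J SJ; rewrite le_admIdeal => a Ja K /(_ _ SJ); rewrite le_admIdeal;
    apply.
- by move=> K SK; rewrite le_admIdeal => a; apply.
Qed.

Definition admIdeal_meet I J := admIdeal_bigcap [set I; J].
Definition admIdeal_join I J := admIdeal_sup [set I; J].

Lemma admIdeal_meet_setE I J : admIdeal_meet I J = (I `&` J)%classic :> set B.
Proof.
apply/seteqP; split=> a /= h.
- by split; apply: h; [left|right].
- by case: h => Ia Ja K [|] ->.
Qed.

Fact le_admIdeal_meet I J K : (I <= admIdeal_meet J K) = (I <= J) && (I <= K).
Proof.
apply/idP/idP.
- rewrite le_admIdeal admIdeal_meet_setE => h; apply/andP; split;
  by rewrite le_admIdeal => a /h [].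
- case/andP; rewrite !le_admIdeal => h1 h2; rewrite admIdeal_meet_setE => a Ia.
  by split; [exact: h1|exact: h2].
Qed.

Fact admIdeal_join_le I J K : (admIdeal_join I J <= K) = (I <= K) && (J <= K).
Proof.
have [ub lub] := admIdeal_supP [set I; J].
apply/idP/andP => [h|[IK JK]].
- by split; apply: le_trans h; apply: ub; [left|right].
- by apply: lub => L [|] ->.
Qed.

HB.instance Definition _ := Order.POrder_MeetJoin_isLattice.Build
  set_display admIdeal le_admIdeal_meet admIdeal_join_le.

Lemma admIdeal_meetE I J :
  (I `&` J)%O = ((I : set B) `&` (J : set B))%classic :> set B.
Proof. exact: admIdeal_meet_setE. Qed.

Fact admIdeal_bot_le I : admIdeal_sup set0 <= I.
Proof. by have [_] := admIdeal_supP set0; apply=> ?. Qed.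

Fact le_admIdeal_top I : I <= admIdeal_bigcap set0.
Proof. by rewrite le_admIdeal => a _ ?. Qed.

HB.instance Definition _ :=
  Order.hasBottom.Build set_display admIdeal admIdeal_bot_le.
HB.instance Definition _ :=
  Order.hasTop.Build set_display admIdeal le_admIdeal_top.

Lemma boolean_meet_supremums (a x : B) (R : set B) :
  supremums R x -> supremums [set a `&` r | r in R] (a `&` x).
Proof.
move=> [ub lub]; split.
- by move=> _ [r Rr <-]; apply: leI2 => //; exact: ub.
- move=> y hy.
  have xy : x <= ~` a `|` y.
    apply: lub => r Rr; have /hy : [set a `&` r | r in R] (a `&` r) by exists r.
    move=> ary; rewrite -[r]meet1x -(joinxC a) meetUl joinC.
    by apply: leU2; [exact: leIl|].
  apply: (@le_trans _ _ (a `&` (~` a `|` y))); first exact: leI2.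
  by rewrite meetUr meetxC join0x leIr.
Qed.

(* K is the Heyting implication of I and J in the frame of ideals. *)
Fact admIdeal_imp_subproof (I J : admIdeal) :
  let K := [set b | forall a, (I : set B) a -> (J : set B) (a `&` b)] in
  `[< ideal K /\ adm_closed K >].
Proof.
have [[J0 Jd JU] Jc] := admIdealP J.
apply/asboolP; rewrite /=; split; first split.
- by move=> a _ /=; rewrite meetx0.
- by move=> b c h bc a /h Jac; apply: Jd Jac _; exact: leI2.
- by move=> b c hb hc a Ia /=; rewrite meetUr; apply: JU; [exact: hb|exact: hc].
- move=> R x AR RI Rx a Ia /=.
  apply: (Jc _ _ (adm_meet a AR) _ (boolean_meet_supremums a Rx)).
  by move=> _ [r /RI h <-]; exact: h.
Qed.

Fact admIdeal_meet_supremums (I : admIdeal) SS J : supremums SS J ->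
  supremums [set I `&` K | K in SS] (I `&` J).
Proof.
move=> [ub lub]; split.
- by move=> _ [K SK <-]; apply: leI2 => //; exact: ub.
- move=> K hK.
  have : J <= AdmIdeal (admIdeal_imp_subproof I K).
    apply: lub => M SM; rewrite le_admIdeal => b Mb a Ia /=.
    have : I `&` M <= K by apply: hK; exists M.
    rewrite le_admIdeal; apply; rewrite admIdeal_meetE.
    have [[_ Id _] _] := admIdealP I; have [[_ Md _] _] := admIdealP M.
    by split; [exact: Id Ia (leIl _ _)|exact: Md Mb (leIr _ _)].
  rewrite !le_admIdeal => h b; rewrite admIdeal_meetE => -[Ib Jb].
  by rewrite -[b]meetxx; exact: h.
Qed.

HB.instance Definition _ := TBLattice_isFrame.Build set_display admIdeal
  (fun SS => ex_intro _ _ (admIdeal_supP SS)) admIdeal_meet_supremums.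

End AdmissibleIdeals.

(* Main.v *)
Require Import Defs.
From HB Require Import structures.
From mathcomp Require Import all_boot all_order.
From mathcomp Require Import boolp classical_sets cardinality.

(** Everything rests on a description of joins in the frame of admissible
    ideals: an element of [B] lies in the join of a family of ideals exactly
    when it is the least upper bound of an admissible set of elements of those
    ideals ([in_admIdeal_sup]).  Principal ideals are admissible ideals and are
    complemented, the complement of [down b] being [down (~` b)]; since an ideal
    is the join of the principal ideals below it, the frame is
    zero-dimensional.

    If admissible sets have disjoint admissible refinements, a cover [C] yields
    an admissible set with join [\top] inside the union of [C], and the nonzero
    principal ideals of a disjoint refinement of it form a partition refining
    [C].

    Conversely, subcompleteness forces every complemented ideal to be principal
    ([complemented_principal]): an admissible set witnessing that [\top] lies in
    the join of [I] and its complement [J] splits into its parts in [I] and in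
    [J], which are both admissible, and the join of the first generates [I].
    A member of a partition is complemented by the join of the other members,
    so a partition amounts to a pairwise disjoint set [T] of elements of [B],
    and [T] is admissible because an admissible set with join [\top] refines
    it ([partition_generators]).
    Given [R] admissible with join [x], apply this to a partition refining the
    cover by the ideals [down r], for [r] in [R], and [down (~` x)], and cut [T]
    down to [x]. *)

Set Implicit Arguments.
Unset Strict Implicit.
Unset Printing Implicit Defensive.

Import Order.LTheory Order.CTheory.
Local Open Scope classical_set_scope.
Local Open Scope order_scope.

(** * Least upper bounds *)

Section Suprema.
Context d (X : porderType d).
Implicit Types (R S : set X) (x y : X).

Lemma supremums_bigcup R x (F : X -> set X) :
  supremums R x -> (forall r, R r -> supremums (F r) r) ->
  supremums (\bigcup_(r in R) F r) x.
Proof.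
move=> [xu xl] FP; split.
- by move=> s [r Rr Fs]; apply: le_trans (xu _ Rr); apply: (FP r Rr).1.
- move=> y yu; apply: xl => r Rr; apply: (FP r Rr).2 => s Fs.
  by apply: yu; exists r.
Qed.

Lemma refines_supremums R S x :
  supremums R x -> refines R S -> (forall s, S s -> s <= x) -> supremums S x.
Proof.
move=> [_ xl] RS Sx; split=> // y yu; apply: xl => r /RS[s Ss rs].
exact: le_trans rs (yu _ Ss).
Qed.

End Suprema.

Lemma supremums0 d (X : bPOrderType d) : supremums (@set0 X) \bot.
Proof. by split=> // y _; exact: le0x. Qed.

Lemma supremums2 d (X : joinSemilatticeType d) (a b : X) :
  supremums [set a; b] (a `|` b).
Proof.
split.
- by move=> _ [|] ->; [exact: leUl|exact: leUr].
- by move=> y yu; rewrite leUx; apply/andP; split; apply: yu; [left|right].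
Qed.

(** The complement is the join of the other members of the partition. *)
Lemma partition_complemented d (L : frameType d) (p : set L) a :
  frame_partition p -> p a -> complemented a.
Proof.
move=> [_ [_ pl] pdisj] pa.
have [b bP] := supremums_ex [set c | p c /\ c <> a]; exists b; split.
- have [_ abl] := meet_supremums a _ _ bP.
  apply/eqP; rewrite -lex0; apply: abl => _ [c [pc ca] <-].
  by rewrite pdisj//; exact/nesym.
- apply/eqP; rewrite -le1x; apply: pl => c pc.
  have [->|/eqP ca] := eqVneq c a; first exact: leUl.
  by apply: le_trans (leUr _ _); apply: bP.1.
Qed.

(** * Joins of admissible ideals *)

Section AdmIdealTheory.
Context d (B : ctbDistrLatticeType d) (A : admSystem B).
Implicit Types (I J : admIdeal A) (R T D : set B) (SS : set (admIdeal A)).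

Lemma admIdeal0 I : (I : set B) \bot.
Proof. by have [[]] := admIdealP I. Qed.

Lemma admIdeal_le I a b : (I : set B) b -> a <= b -> (I : set B) a.
Proof. by have [[_ h _] _] := admIdealP I; exact: h. Qed.

Lemma admIdealU I a b : (I : set B) a -> (I : set B) b ->
  (I : set B) (a `|` b).
Proof. by have [[_ _ h] _] := admIdealP I; exact: h. Qed.

Lemma admIdeal_closed I R x : adm A R -> (R `<=` I)%classic ->
  supremums R x -> (I : set B) x.
Proof. by have [_ h] := admIdealP I; exact: h. Qed.

Lemma admIdeal_leP I J a : I <= J -> (I : set B) a -> (J : set B) a.
Proof. by rewrite le_admIdeal; apply. Qed.

(** The empty set and pairs are admissible, so closure under admissible joins
    subsumes closure under finite joins. *)
Lemma down_closed_admIdeal D : (forall a b, D b -> a <= b -> D a) ->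
  adm_closed A D -> `[< ideal D /\ adm_closed A D >].
Proof.
move=> Dd Dc; apply/asboolP; split=> //; split=> //.
- by apply: (Dc set0 _ _ _ (supremums0 _)) => //; exact: adm_finite.
- move=> a b Da Db; apply: (Dc [set a; b] _ _ _ (supremums2 a b)).
  + exact/adm_finite/finite_set2.
  + by move=> _ [|] ->.
Qed.

Definition adm_joins D : set B :=
  [set x | exists R, [/\ adm A R, (R `<=` D)%classic & supremums R x]].

Fact adm_joins_subproof SS :
  let D := adm_joins (\bigcup_(I in SS) (I : set B)) in
  `[< ideal D /\ adm_closed A D >].
Proof.
apply: down_closed_admIdeal.
- move=> a b [R [AR RD Rb]] ab; exists [set a `&` r | r in R]; split.
  + exact: adm_meet.
  + move=> _ [r /RD[I SI Ir] <-]; exists I => //.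
    exact: admIdeal_le Ir (leIr _ _).
  + by rewrite -[X in supremums _ X](meet_l ab);
      exact: boolean_meet_supremums.
- move=> R x AR RD Rx.
  have /choice[F FP] r : exists S : set B, R r ->
      [/\ adm A S, (S `<=` \bigcup_(I in SS) (I : set B))%classic &
          supremums S r].
    have [/RD[S SP]|nRr] := pselect (R r); first by exists S.
    by exists set0 => /nRr.
  exists (\bigcup_(r in R) F r); split.
  + by apply: adm_bigcup => // r /FP[].
  + by move=> s [r /FP[_ h _] /h].
  + by apply: supremums_bigcup => // r /FP[].
Qed.

(** The admissible joins of elements of the ideals in [SS] already form an
    admissible ideal, by closure of admissible sets under meets and unions; it
    contains every member of [SS], hence also the join of [SS]. *)
Lemma in_admIdeal_sup SS J x : supremums SS J -> (J : set B) x ->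
  exists R, [/\ adm A R, (R `<=` \bigcup_(I in SS) (I : set B))%classic &
                supremums R x].
Proof.
move=> [_ Jl]; apply: (@admIdeal_leP _ (AdmIdeal (adm_joins_subproof SS))).
apply: Jl => I SI; rewrite le_admIdeal => a Ia; exists [set a]; split.
- exact/adm_finite/finite_set1.
- by move=> _ ->; exists I.
- by rewrite supremums1.
Qed.

Lemma admIdeal_meetP I J a :
  (I : set B) a -> (J : set B) a -> ((I `&` J)%O : set B) a.
Proof. by move=> Ia Ja; rewrite admIdeal_meetE. Qed.

(** * Principal ideals *)

Fact down_subproof (b : B) :
  `[< ideal [set a | a <= b] /\ adm_closed A [set a | a <= b] >].
Proof.
apply: down_closed_admIdeal => [a c|R x _ Rb [_ xl]] /=.
- by move=> cb ac; exact: le_trans cb.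
- exact: xl.
Qed.
Definition down (b : B) : admIdeal A := AdmIdeal (down_subproof b).

Lemma down_le b I : (down b <= I) = (I : set B) b :> Prop.
Proof.
rewrite le_admIdeal propeqE; split=> [h|Ib a /=]; first exact: h (lexx b).
exact: admIdeal_le.
Qed.

Lemma admIdeal_topE I : (I : set B) \top -> I = \top.
Proof.
move=> I1; apply: le_anti; rewrite lex1 /= le_admIdeal => a _.
exact: admIdeal_le I1 (lex1 a).
Qed.

Lemma admIdeal_botP a : ((\bot : admIdeal A) : set B) a -> a = \bot.
Proof.
by rewrite -down_le => h; apply/eqP; rewrite -lex0;
   exact: (admIdeal_leP (le_trans h (le0x (down \bot))) (lexx a)).
Qed.

Lemma down0 : down \bot = \bot.
Proof. by apply: le_anti; rewrite le0x andbT down_le; exact: admIdeal0. Qed.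

Lemma meet_down a b : down a `&` down b = down (a `&` b).
Proof.
apply: val_inj; rewrite [LHS]admIdeal_meetE; apply/seteqP.
by split=> c /=; [case=> ca cb; rewrite lexI ca|rewrite lexI => /andP[]].
Qed.

Lemma down_complemented b : complemented (down b).
Proof.
exists (down (~` b)); split; first by rewrite meet_down meetxC down0.
apply: admIdeal_topE; rewrite -(joinxC b).
by apply: admIdealU; rewrite -down_le; [exact: leUl|exact: leUr].
Qed.

Lemma admIdeal_cover SS :
  (forall J, ubound SS J -> (J : set B) \top) -> supremums SS \top.
Proof.
by move=> h; split=> [I _|J /h/admIdeal_topE ->//]; exact: lex1.
Qed.

Lemma admIdeal_zero_dimensional : zero_dimensional (admIdeal A).
Proof.
move=> I; split=> [J []//|J Ju]; rewrite le_admIdeal => a Ia.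
rewrite -down_le; apply: Ju; split; first exact: down_complemented.
by rewrite down_le.
Qed.

(** * Disjoint refinements give partitions *)

Lemma disjoint_refinement_ultraparacompact :
  (forall R, adm A R -> exists S, [/\ adm A S, refines S R,
     exists2 x, supremums R x & supremums S x & pairwise_disjoint S]) ->
  ultraparacompact (admIdeal A).
Proof.
move=> hR; split=> [|C Ccov]; first exact: admIdeal_zero_dimensional.
have [R [AR RC R1]] : exists R, [/\ adm A R,
    (R `<=` \bigcup_(I in C) (I : set B))%classic & supremums R \top].
  by apply: in_admIdeal_sup Ccov _; rewrite -down_le; exact: lex1.
have [S [AS SR [x Rx Sx] Sdisj]] := hR R AR.
have Dx := is_subset1_supremums Rx R1; rewrite {x Rx}Dx in Sx.
exists [set I | I <> \bot /\ exists2 s, S s & I = down s].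
- split; first by case.
  + apply: admIdeal_cover => J Ju; apply: (admIdeal_closed AS _ Sx) => s Ss.
    have [->|s0] := eqVneq s \bot; first exact: admIdeal0.
    rewrite -down_le; apply: Ju; split; last by exists s.
    move=> ds; move/eqP: s0; apply; apply: admIdeal_botP.
    by rewrite -ds /=.
  + move=> _ _ [_ [s Ss ->]] [_ [t St ->]] st.
    by rewrite meet_down Sdisj ?down0// => E; apply: st; rewrite E.
- move=> _ [_ [s Ss ->]]; have [r Rr sr] := SR s Ss.
  have [I CI Ir] := RC r Rr; exists I => //; rewrite down_le.
  exact: admIdeal_le Ir sr.
Qed.

(** * Partitions give disjoint refinements *)

Hypothesis hA : subcomplete A.

(** Subcompleteness enters here: an admissible set [R] contained in the union of
    [I] and [J], with join [\top], splits into two admissible parts [R `&` I] and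
    [R `&` J]. *)
Lemma complemented_principal I : complemented I -> exists a, I = down a.
Proof.
move=> [J [IJ0 IJ1]].
have disj a b : (I : set B) a -> (J : set B) b -> a `&` b = \bot.
  move=> Ia Jb; apply: admIdeal_botP; rewrite -IJ0; apply: admIdeal_meetP.
  - exact: admIdeal_le Ia (leIl _ _).
  - exact: admIdeal_le Jb (leIr _ _).
have [R [AR RIJ [_ Rl]]] : exists R, [/\ adm A R,
    (R `<=` \bigcup_(K in [set I; J]) (K : set B))%classic & supremums R \top].
  by apply: in_admIdeal_sup (supremums2 I J) _; rewrite IJ1 -down_le lex1.
have RE : R = ((R `&` I) `|` (R `&` J))%classic.
  apply/seteqP; split=> [r Rr|r [[]|[]]//].
  by have [K [|] -> Kr] := RIJ r Rr; [left|right].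
rewrite RE in AR; case: (hA AR) => [r s [_ Ir] [_ Js]|AI AJ]; first exact: disj.
have [a aP] := adm_lub AI; have [b bP] := adm_lub AJ.
have Ia : (I : set B) a by apply: (admIdeal_closed AI _ aP) => r [].
have Jb : (J : set B) b by apply: (admIdeal_closed AJ _ bP) => r [].
have ab1 : a `|` b = \top.
  apply/eqP; rewrite -le1x; apply: Rl => r; rewrite {1}RE => -[Rr|Rr].
  - exact: le_trans (aP.1 _ Rr) (leUl _ _).
  - exact: le_trans (bP.1 _ Rr) (leUr _ _).
exists a; apply: le_anti; apply/andP; split; last by rewrite down_le.
rewrite le_admIdeal => c Ic /=.
by rewrite -[c]meetx1 -ab1 meetUr (disj c b) // joinx0; exact: leIr.
Qed.

(** The generators of the members of a partition are refined by the admissible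
    set that writes [\top] as a join of elements of these members. *)
Lemma partition_generators (p : set (admIdeal A)) : frame_partition p ->
  exists T, [/\ adm A T, supremums T \top, pairwise_disjoint T &
                forall t, T t -> p (down t)].
Proof.
move=> pP; have [_ p1 pdisj] := pP.
have [Q [AQ Qp Q1]] : exists Q, [/\ adm A Q,
    (Q `<=` \bigcup_(I in p) (I : set B))%classic & supremums Q \top].
  by apply: in_admIdeal_sup p1 _; rewrite -down_le lex1.
pose T : set B := [set t | p (down t)].
have QT : refines Q T.
  move=> q /Qp[I pI Iq].
  have [a Ia] := complemented_principal (partition_complemented pP pI).
  by exists a; [rewrite /T /= -Ia|rewrite Ia in Iq].
exists T; split=> //.
- by apply: adm_refine AQ Q1 _ QT => t _; exact: lex1.
- by apply: refines_supremums Q1 QT _ => t _; exact: lex1.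
- move=> s t ps pt st; apply: admIdeal_botP; rewrite -(pdisj _ _ ps pt).
  + by rewrite meet_down /=.
  + move=> E; apply: st; apply: le_anti; apply/andP; split.
    * by have : (down t : set B) s by rewrite -E /=.
    * by have : (down s : set B) t by rewrite E /=.
Qed.

Lemma ultraparacompact_disjoint_refinement : ultraparacompact (admIdeal A) ->
  forall R, adm A R -> exists S, [/\ adm A S, refines S R,
    exists2 x, supremums R x & supremums S x & pairwise_disjoint S].
Proof.
move=> [_ upc] R AR; have [x Rx] := adm_lub AR.
(* A generator below [~` x] contributes [\bot] once cut down to [x], and the
   refinement then still needs some element of [R] above it. *)
have [->|/set0P[r0 Rr0]] := eqVneq R set0.
  exists set0; split=> //; first exact: adm_finite.
  by exists \bot; exact: supremums0.
pose C := (down @` (R `|` [set (~` x)%O]))%classic.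
have Ccov : frame_cover C.
  apply: admIdeal_cover => J Ju; rewrite -(joinxC x); apply: admIdealU.
  - apply: (admIdeal_closed AR _ Rx) => r Rr; rewrite -down_le.
    by apply: Ju; exists r => //; left.
  - by rewrite -down_le; apply: Ju; exists (~` x) => //; right.
have [p pP pC] := upc C Ccov.
have [T [AT T1 Tdisj Tp]] := partition_generators pP.
exists [set x `&` t | t in T]; split.
- exact: adm_meet.
- move=> _ [t Tt <-]; have [_ [r rP <-]] := pC _ (Tp _ Tt).
  rewrite down_le /= => tr; case: rP tr => [Rr tr|-> tx].
  + by exists r => //; exact: le_trans (leIr _ _) tr.
  + exists r0 => //; apply: le_trans (le0x r0).
    by rewrite -(meetxC x); exact: leI2.
- by exists x => //; rewrite -[x in supremums _ x]meetx1;
    exact: boolean_meet_supremums.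
- move=> _ _ [s Ts <-] [t Tt <-] st.
  by rewrite meetACA (Tdisj s t) ?meetx0// => E; apply: st; rewrite E.
Qed.

End AdmIdealTheory.

Theorem theorem22 (d : Order.disp_t) (B : ctbDistrLatticeType d)
    (A : admSystem B) (hA : subcomplete A) :
  ultraparacompact (admIdeal A) <->
  (forall R : set B, adm A R ->
     exists S : set B,
       [/\ adm A S, refines S R, (exists2 x : B, supremums R x & supremums S x)
         & pairwise_disjoint S]).
Proof.
split; first exact: ultraparacompact_disjoint_refinement.
exact: disjoint_refinement_ultraparacompact.
Qed.
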